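(* Consider the following random graph process: start with two vertices joined by an edge; at each time step choose an edge $\{u,w\}$ of the current graph uniformly at random, add a new vertex $v$, and add the edges $\{v,u\}$ and $\{v,w\}$. Then the local clustering coefficient of a vertex with degree $d$ is $2/d$ at any time of the generation process.
   Context: The local clustering coefficient of a vertex $i$ of degree $d_i$ is $\dfrac{2E_i}{d_i(d_i-1)}$, where $E_i$ is the number of edges among the neighbors of $i$. The process is the algorithm called SE-A with parameter $z=1$ (for which the sampling step amounts to a uniformly random edge selection) and with initial graph consisting of two connected vertices. *)

(* Defs.v *)
From HB Require Import structures.
From mathcomp Require Import all_boot all_order all_algebra.
From mathcomp Require Import all_classical all_reals all_analysis.

Set Implicit Arguments.
Unset Strict Implicit.
Unset Printing Implicit Defensive.

Import Order.TTheory GRing.Theory Num.Theory.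

Local Open Scope ring_scope.

Record sgraph (V : finType) := SGraph {
  edges : {set {set V}};
  edges_card2 : forall f, f \in edges -> #|f| = 2%N }.

Definition neighbors (V : finType) (G : sgraph V) (v : V) : {set V} :=
  [set u | [set v; u]%SET \in edges G]%SET.

Definition degree (V : finType) (G : sgraph V) (v : V) : nat :=
  #|neighbors G v|.

Definition edges_among (V : finType) (G : sgraph V) (A : {set V}) : nat :=
  #|[set f in edges G | f \subset A]%SET|.

(* The coefficient is undefined at vertices of degree at most 1, where the
   denominator vanishes and the total division below returns 0. *)
Definition local_clustering (R : fieldType) (V : finType) (G : sgraph V)
    (v : V) : R :=
  2 * (edges_among G (neighbors G v))%:R /
  ((degree G v)%:R * ((degree G v)%:R - 1)).

Lemma initial_card2 (f : {set 'I_2}) :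
  f \in [set [set ord0; ord_max]]%SET -> #|f| = 2%N.
Proof. by move=> /set1P ->; rewrite cards2. Qed.

Definition initial_graph : sgraph 'I_2 := SGraph initial_card2.

(* The old vertices are embedded by [lift ord_max], which preserves values;
   [ord_max] is the new vertex. *)
Definition attach_edges n (E : {set {set 'I_n}}) (e : {set 'I_n}) :
    {set {set 'I_n.+1}} :=
  ([set lift ord_max @: f | f : {set 'I_n} in E] :|:
   [set [set ord_max; lift ord_max u] | u in e])%SET.

Lemma attach_card2 n (G : sgraph 'I_n) (e : {set 'I_n}) (f : {set 'I_n.+1}) :
  f \in attach_edges (edges G) e -> #|f| = 2%N.
Proof.
case/setUP => /imsetP[g gP ->].
  by rewrite card_imset ?(edges_card2 gP)//; exact: lift_inj.
by rewrite cards2 neq_lift.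
Qed.

Definition attach n (G : sgraph 'I_n) (e : {set 'I_n}) : sgraph 'I_n.+1 :=
  SGraph (@attach_card2 n G e).

(* [h t] is the edge selected in the graph at time [t], whose vertices are
   [0, ..., t + 1]. *)
Fixpoint graph_at (h : forall t : nat, {set 'I_t.+2}) (t : nat) :
    sgraph 'I_t.+2 :=
  if t is s.+1 then attach (graph_at h s) (h s) else initial_graph.

Definition uniform_pmf (R : fieldType) (I : finType) (A : {set I}) (i : I) : R :=
  if i \in A then #|A|%:R^-1 else 0.

(* The event that the first [t] selections are those of [h]. *)
Definition history (T : Type) (e : forall t : nat, T -> {set 'I_t.+2})
    (h : forall t : nat, {set 'I_t.+2}) (t : nat) : set T :=
  [set w | forall s : nat, (s < t)%N -> e s w = h s]%classic.

(* [e t] is the random edge selected at time [t]. The last field says that,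
   conditionally on the previous selections, [e t] is uniform on the edges of
   the current graph; it is in product form, so that histories of probability
   0 need no separate treatment. *)
Record random_edge_selection (R : realType) (d : measure_display)
    (T : measurableType d) (P : probability T R)
    (e : forall t : nat, T -> {set 'I_t.+2}) : Prop := {
  selection_measurable : forall (t : nat) (f : {set 'I_t.+2}),
    measurable [set w | e t w = f]%classic;
  selection_edge : forall (t : nat) (w : T),
    e t w \in edges (graph_at (fun s => e s w) t);
  selection_uniform : forall (t : nat) (h : forall t : nat, {set 'I_t.+2}),
    P (history e h t.+1) =
    (P (history e h t) * (uniform_pmf R (edges (graph_at h t)) (h t))%:E)%E }.

(* Main.v *)
(* By induction on time, the neighbourhood of a vertex of degree d spans
   exactly d - 1 edges: an old vertex x gains the new neighbour and one edge
   among its neighbours precisely when the selected edge contains x, the new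
   edge joining the new vertex to the other endpoint; the neighbourhood of the
   new vertex is the selected edge itself.  After the first step all degrees
   are at least 2, so 2 (d - 1) / (d (d - 1)) simplifies to 2 / d. *)
Require Import Defs.
From HB Require Import structures.
From mathcomp Require Import all_boot all_order all_algebra.
From mathcomp Require Import all_classical all_reals all_analysis.

Import Order.TTheory GRing.Theory Num.Theory.

Local Open Scope ring_scope.

Lemma card_lift_max n (B : {set 'I_n.+1}) :
  #|B| = (#|lift ord_max @^-1: B|%SET + (ord_max \in B))%N.
Proof.
rewrite -!sum1_card big_mkcond big_ord_recr /= -big_mkcond /=.
(* [big_ord_recr] embeds the old indices by [widen_ord], which agrees with [lift ord_max] on
   values. *)
congr (_ + _)%N.
apply: eq_bigl => i; rewrite inE; congr (_ \in mem B).
by apply: val_inj; exact: esym (lift_max i).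
Qed.

Lemma setU2_imset (aT rT : finType) (f : aT -> rT) (x y : aT) :
  (f @: [set x; y] = [set f x; f y])%SET.
Proof. by rewrite imsetU1 imset_set1. Qed.

Lemma max_notin_imset_lift n (A : {set 'I_n}) :
  (ord_max \in (lift ord_max @: A)%SET) = false.
Proof. by apply/imsetP => -[i _ /eqP]; rewrite (negPf (neq_lift _ _)). Qed.

Lemma set2_lift_inj n :
  injective (fun u : 'I_n => [set ord_max; lift ord_max u]%SET).
Proof.
move=> u1 u2 /setP/(_ (lift ord_max u1)).
rewrite !inE eqxx orbT eq_sym (negPf (neq_lift _ _)) /=.
by move/esym/eqP/lift_inj.
Qed.

(** Every added edge contains [ord_max], which no lifted set does, so attaching neither creates nor
    destroys edges between old vertices. *)
Lemma imset_lift_attach n (E : {set {set 'I_n}}) (e f : {set 'I_n}) :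
  ((lift ord_max @: f)%SET \in attach_edges E e) = (f \in E).
Proof.
rewrite finset.in_setU mem_imset; last by apply: imset_inj; exact: lift_inj.
case: (f \in E) => //=; apply/imsetP => -[u _ eq_f].
by have := max_notin_imset_lift n f; rewrite eq_f !inE eqxx.
Qed.

Lemma set2_max_attach n (E : {set {set 'I_n}}) (e : {set 'I_n}) (u : 'I_n) :
  ([set ord_max; lift ord_max u]%SET \in attach_edges E e) = (u \in e).
Proof.
rewrite finset.in_setU (mem_imset _ _ (set2_lift_inj n)) orbC.
case: (u \in e) => //=; apply/imsetP => -[f _ eq_f].
by have := max_notin_imset_lift n f; rewrite -eq_f !inE eqxx.
Qed.

Lemma in_neighbors (V : finType) (H : sgraph V) (x y : V) :
  (y \in neighbors H x) = ([set x; y]%SET \in edges H).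
Proof. by rewrite inE. Qed.

Lemma neighbors_irr (V : finType) (H : sgraph V) (x : V) :
  (x \in neighbors H x) = false.
Proof.
by rewrite in_neighbors finset.setUid; apply/negP => /edges_card2; rewrite cards1.
Qed.

Section Attach.
Variables (n : nat) (G : sgraph 'I_n) (e : {set 'I_n}).

Lemma edges_among_attach (B : {set 'I_n.+1}) :
  edges_among (attach G e) B =
  (edges_among G (lift ord_max @^-1: B)%SET +
   (ord_max \in B) * #|e :&: (lift ord_max @^-1: B)|%SET)%N.
Proof.
set A := (lift ord_max @^-1: B)%SET.
set E1 := [set f in edges G | f \subset A]%SET.
set e1 := (if ord_max \in B then e :&: A else finset.set0)%SET.
(* Restricting to [B] commutes with attaching: what survives are the old edges inside [A] and, if
   [B] contains the new vertex, the new edges ending in [A]. These two families are disjoint, so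
   their sizes add. *)
have -> : edges_among (attach G e) B = #|attach_edges E1 e1|.
  apply: eq_card => f; rewrite !inE.
  apply/andP/orP => [[/orP[]/imsetP[g gP ->] fB]|[]/imsetP[g gP ->]].
  - by left; apply: imset_f; rewrite inE gP -sub_imset_pre.
  - right; apply: imset_f; rewrite /e1.
    move: fB; rewrite finset.subUset !finset.sub1set => /andP[-> gB].
    by rewrite inE gP inE.
  - move: gP; rewrite inE => /andP[gE gA].
    rewrite sub_imset_pre; split=> //; apply/orP; left; exact: imset_f.
  - move: gP; rewrite /e1; case: ifP => [mB|]; rewrite !inE //.
    move=> /andP[ge gB]; rewrite finset.subUset !finset.sub1set mB.
    by split=> //; apply/orP; right; exact: imset_f.
rewrite cardsU disjoint_setI0 ?cards0 ?subn0; last first.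
  apply/pred0P => f /=; apply/andP => -[/imsetP[g _ ->] /imsetP[u _ eq_g]].
  by have := max_notin_imset_lift n g; rewrite eq_g !inE eqxx.
rewrite !card_imset; [|exact: set2_lift_inj|exact: imset_inj (@lift_inj _ _)].
by rewrite /e1; case: ifP => _; rewrite ?cards0 ?mul1n.
Qed.

(** A neighbourhood after attaching is described by its old part and by whether it contains
    [ord_max], the two data that [card_lift_max] and [edges_among_attach] take as input. *)
Lemma neighbors_attach_old (x : 'I_n) :
  (lift ord_max @^-1: neighbors (attach G e) (lift ord_max x))%SET =
  neighbors G x.
Proof. by apply/setP => u; rewrite inE !in_neighbors -setU2_imset imset_lift_attach. Qed.

Lemma max_neighbors_attach_old (x : 'I_n) :
  (ord_max \in neighbors (attach G e) (lift ord_max x)) = (x \in e).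
Proof. by rewrite in_neighbors finset.setUC set2_max_attach. Qed.

Lemma neighbors_attach_new :
  (lift ord_max @^-1: neighbors (attach G e) ord_max)%SET = e.
Proof. by apply/setP => u; rewrite inE in_neighbors set2_max_attach. Qed.

Lemma degree_attach_old (x : 'I_n) :
  degree (attach G e) (lift ord_max x) = (degree G x + (x \in e))%N.
Proof.
by rewrite /degree card_lift_max neighbors_attach_old max_neighbors_attach_old.
Qed.

Lemma degree_attach_new : degree (attach G e) ord_max = #|e|.
Proof.
by rewrite /degree card_lift_max neighbors_attach_new neighbors_irr addn0.
Qed.

Hypothesis eG : e \in edges G.

(** Write [e] as [[set x; u]]: [u] is adjacent to [x] through [e] itself, while [x] is not its own
    neighbour since a loop would be an edge of cardinality 1. *)
Lemma card_edge_neighbors (x : 'I_n) :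
  x \in e -> #|e :&: neighbors G x|%SET = 1%N.
Proof.
move=> xe; have := edges_card2 eG; rewrite (cardsD1 x) xe => -[/eqP].
move=> /cards1P[u eu]; have eE : e = [set x; u]%SET by rewrite -eu finset.setD1K.
have ux : (u == x) = false by have := set11 u; rewrite -eu !inE; case: eqP.
apply/eqP/cards1P; exists u; apply/setP => y.
rewrite finset.in_setI finset.in_set1 {1}eE !inE.
case: (eqVneq y x) => [->|_] /=.
  by rewrite finset.setUid eq_sym ux; apply/negP => /edges_card2; rewrite cards1.
by case: (eqVneq y u) => // ->; rewrite -eE.
Qed.

Lemma edges_among_edge : edges_among G e = 1%N.
Proof.
apply/eqP/cards1P; exists e; apply/setP => f; rewrite !inE.
apply/andP/eqP => [[fG fe]|-> //].
by apply/eqP; rewrite eqEcard fe !(edges_card2 fG, edges_card2 eG).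
Qed.

(** The invariant uses a successor instead of [degree - 1], which avoids truncated subtraction. *)
Lemma edges_among_neighbors_attach :
  (forall x, degree G x = (edges_among G (neighbors G x)).+1) ->
  forall x, degree (attach G e) x =
            (edges_among (attach G e) (neighbors (attach G e) x)).+1.
Proof.
move=> IH x; rewrite edges_among_attach.
case: (unliftP ord_max x) => [y|] ->.
  rewrite degree_attach_old neighbors_attach_old max_neighbors_attach_old IH.
  (* Both sides grow by 1 if [y] lies on [e], and by 0 otherwise. *)
  by case: (boolP (y \in e)) => [/card_edge_neighbors ->|_]; rewrite addSn.
rewrite degree_attach_new neighbors_attach_new neighbors_irr mul0n addn0.
by rewrite edges_among_edge; exact: edges_card2 eG.
Qed.

End Attach.

Lemma degree_initial (x : 'I_2) : degree initial_graph x = 1%N.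
Proof.
(* On two vertices [rev_ord] is the swap, so it gives the unique neighbour. *)
apply/eqP/cards1P; exists (rev_ord x); apply/setP => y; rewrite !inE.
apply/eqP/eqP => [exy|->].
  have /setP exyP := exy; have := exyP ord_max; have := exyP ord0; rewrite !inE.
  by case: x {exy exyP} => -[|[]]// ?; case: y => -[|[]]// ? _ _; exact/val_inj.
by apply/setP => z; rewrite !inE; case: x z => -[|[]]// ? [[|[]]].
Qed.

Section Process.
Variable h : forall t : nat, {set 'I_t.+2}.
Hypothesis h_edge : forall t, h t \in edges (graph_at h t).

Lemma degree_graph_at t (x : 'I_t.+2) :
  degree (graph_at h t) x =
  (edges_among (graph_at h t) (neighbors (graph_at h t) x)).+1.
Proof.
elim: t x => [|t IH] x; last exact: edges_among_neighbors_attach.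
(* Initially each neighbourhood is a single vertex, too small to contain an edge. *)
rewrite degree_initial; congr _.+1; apply/esym/eqP; rewrite cards_eq0.
apply/eqP/setP => f; rewrite finset.in_set0; apply/setIdP => -[fE /subset_leq_card].
by rewrite (edges_card2 fE) -/(degree _ _) degree_initial.
Qed.

(** A new vertex has degree 2 and degrees never decrease. The first selection is the unique initial
    edge, which raises both initial degrees from 1 to 2. *)
Lemma degree_graph_at_gt1 t (x : 'I_t.+3) : (1 < degree (graph_at h t.+1) x)%N.
Proof.
elim: t x => [|t IH] x /=;
  case: (unliftP ord_max x) => [y|] ->;
  rewrite ?degree_attach_new ?(edges_card2 (h_edge _)) // degree_attach_old.
  have := h_edge 0; rewrite degree_initial => /set1P ->.
  by rewrite !inE; case: y => -[|[]].
exact: leq_trans (IH y) (leq_addr _ _).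
Qed.

End Process.

Theorem theorem7 (R : realType) (disp : measure_display)
    (T : measurableType disp) (P : probability T R)
    (e : forall t : nat, T -> {set 'I_t.+2})
    (he : random_edge_selection P e)
    (w : T) (t : nat) (ht : (0 < t)%N) (v : 'I_t.+2) (d : nat)
    (hd : degree (graph_at (fun s => e s w) t) v = d) :
  local_clustering R (graph_at (fun s => e s w) t) v = 2 / d%:R.
Proof.
(* The claim is pathwise: the outcome [w] fixes a sequence of selected edges. *)
have h_edge s := selection_edge he s w.
have d_gt1 : (1 < d)%N.
  by rewrite -hd; case: t ht v {hd} => // t _ v; exact: degree_graph_at_gt1.
have := degree_graph_at _ h_edge t v; rewrite /local_clustering hd.
(* With the degree written [d.+1], the edge count becomes [d], which is positive and cancels against
   the factor [d.+1 - 1]. *)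
case: d d_gt1 {hd} => [|d] // d_gt0 [<-].
rewrite -[X in _ * (X - 1)]natr1 addrK -mulf_div divff ?mulr1 //.
by rewrite pnatr_eq0 -lt0n.
Qed.
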